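(* Let $Q$ be a nonempty compact topological space, let $C(Q)$ be the Banach space of real continuous functions on $Q$ with the supremum norm, ordered by the cone $K$ of nonnegative functions, and let $A\in L(C(Q))$ be a Markov operator. Suppose that some power of $A$ is a compact operator (in particular, this is the case if $A$ is weakly compact) and that $A$ satisfies the condition of regularity: for some $m\in\mathbb{N}$ the inequality $A^m(x)>0$ holds everywhere on $Q$ for each nonnegative function $x\in C(Q)$ that is not identically zero. Then the sequence $\{A^n\}_{n\ge0}$ converges in the operator norm to some operator $A_0\in L(C(Q))$ (and hence $(A^* )^n\to A_0^*$ in the operator norm), and there exist $u\in \mathrm{int}(K)$ and a positive functional $f_0\in C^*(Q)$ such that (i) $A(u)=u$, $A^*(f_0)=f_0$, $f_0(u)=1$, and $f_0(x)>0$ for every $x\in K$, $x\neq 0$; (ii) $A_0=f_0\otimes u$; (iii) for each $f\in C^*(Q)$ one has $(A^* )^n(f)\to A_0^*(f)$ in the weak*-topology $\sigma(C^*(Q),C(Q))$; (iv) $\lambda=1$ is a simple eigenvalue of $A$ and of $A^*$; (v) $\sup_{\mu}\|(A^* )^n(\mu)-f_0\|\to 0$ as $n\to\infty$, where the supremum is over all probability measures $\mu\in C^*(Q)$; in particular $(A^* )^n(\mu)\to f_0$ in variation for every probability measure $\mu\in C^*(Q)$.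
   Context: $C^*(Q)$ denotes the dual of $C(Q)$; a probability measure in $C^*(Q)$ is a positive functional $\mu$ with $\mu(\mathbf 1)=1$, where $\mathbf 1$ is the function identically equal to $1$. Convergence in variation is convergence in the norm of $C^*(Q)$. An operator $A\in L(C(Q))$ (continuous linear) is a Markov operator if it is positive ($A(K)\subset K$) and $A(\mathbf 1)=\mathbf 1$. $A^*$ is the adjoint operator on $C^*(Q)$. $\mathrm{int}(K)$ is the norm interior of $K$. ''Some power'' means $A^k$ for some $k\in\mathbb{N}=\{1,2,\dots\}$. $f_0\otimes u$ is the operator $x\mapsto f_0(x)u$. An eigenvalue is called simple if its eigenspace is one-dimensional. *)

(* Defs.v *)
From HB Require Import structures.
From mathcomp Require Import all_boot all_order all_algebra.
From mathcomp Require Import all_classical all_reals all_analysis.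

Set Implicit Arguments.
Unset Strict Implicit.
Unset Printing Implicit Defensive.

Import Order.TTheory GRing.Theory Num.Theory.
Import numFieldNormedType.Exports.

Local Open Scope classical_set_scope.
Local Open Scope ring_scope.

(* The compactness of Q is an argument of the type [cfun] so that the
   supremum norm can be a canonical structure on it. *)
Section ContinuousFunctions.
Context {R : realType} {Q : topologicalType}.

Definition continuous_pred : {pred Q -> R} :=
  mem [set x : Q -> R | continuous x].

Record cfun (cQ : compact [set: Q]) :=
  CFun { cfun_val :> Q -> R; cfun_valP : cfun_val \in continuous_pred }.

Variable cQ : compact [set: Q].
Local Notation CQ := (cfun cQ).

HB.instance Definition _ := [isSub of CQ for @cfun_val cQ].
HB.instance Definition _ := [Choice of CQ by <:].

Lemma continuous_submod_closed : submod_closed continuous_pred.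
Proof.
split; first by rewrite inE => q; exact: cvg_cst.
move=> a x y; rewrite !inE => cx cy q.
by apply: cvgD; [apply: cvgZl_tmp; exact: cx | exact: cy].
Qed.

HB.instance Definition _ := GRing.isSubmodClosed.Build R (Q -> R)
  continuous_pred continuous_submod_closed.
HB.instance Definition _ := [SubChoice_isSubLmodule of CQ by <:].

Lemma cfun_continuous (x : CQ) : continuous x.
Proof. by have := cfun_valP x; rewrite inE. Qed.

Lemma cfunP (x y : CQ) : (forall q, x q = y q) -> x = y.
Proof. by move=> xy; apply/val_inj/funext. Qed.

Definition cfun_norm (x : CQ) : R := sup (range (fun q => `|x q|)).

Lemma cfun_has_ubound (x : CQ) : has_ubound (range (fun q => `|x q|)).
Proof.
have cx : {within [set: Q], continuous (fun q => `|x q|)}.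
  apply: continuous_subspaceT => q.
  by apply: cvg_norm; exact: cfun_continuous.
have [M [_ HM]] := compact_bounded (continuous_compact cx cQ).
exists (M + 1) => y xy.
by rewrite (le_trans (ler_norm _))// (HM (M + 1))// ltrDl.
Qed.

Lemma cfun_norm_ge (x : CQ) q : `|x q| <= cfun_norm x.
Proof. by apply: ub_le_sup; [exact: cfun_has_ubound|exists q]. Qed.

Lemma cfun_norm_le (x : CQ) (M : R) :
  0 <= M -> (forall q, `|x q| <= M) -> cfun_norm x <= M.
Proof.
move=> M0 xM; have [q0|nq] := pselect (exists q : Q, True).
  case: q0 => q0 _; apply: ge_sup => [|_ [q _ <-]//].
  by exists `|x q0|, q0.
have r0 : range (fun q => `|x q|) = set0.
  by rewrite -subset0 => t [q] *; apply: nq; exists q.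
by rewrite /cfun_norm r0 sup0.
Qed.

Lemma cfun_norm_ge0 (x : CQ) : 0 <= cfun_norm x.
Proof.
have [q0|nq] := pselect (exists q : Q, True).
  by case: q0 => q0 _; exact: le_trans (cfun_norm_ge x q0).
have r0 : range (fun q => `|x q|) = set0.
  by rewrite -subset0 => t [q] *; apply: nq; exists q.
by rewrite /cfun_norm r0 sup0.
Qed.

Lemma cfun_ler_normD (x y : CQ) :
  cfun_norm (x + y) <= cfun_norm x + cfun_norm y.
Proof.
apply: cfun_norm_le => [|q]; first by rewrite addr_ge0 ?cfun_norm_ge0.
by rewrite (le_trans (ler_normD _ _))// lerD ?cfun_norm_ge.
Qed.

Lemma cfun_normZ (a : R) (x : CQ) : cfun_norm (a *: x) = `|a| * cfun_norm x.
Proof.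
have le b y : cfun_norm (b *: y) <= `|b| * cfun_norm y.
  apply: cfun_norm_le => [|q]; first by rewrite mulr_ge0 ?cfun_norm_ge0.
  by rewrite normrM ler_wpM2l ?cfun_norm_ge.
apply/eqP; rewrite eq_le le/=; have [->|a0] := eqVneq a 0.
  by rewrite normr0 mul0r cfun_norm_ge0.
by have := le a^-1 (a *: x); rewrite scalerK// normfV ler_pdivlMl ?normr_gt0.
Qed.

Lemma cfun_norm0_eq0 (x : CQ) : cfun_norm x = 0 -> x = 0.
Proof.
by move=> x0; apply: cfunP => q; apply/eqP; rewrite -normr_le0 -x0 cfun_norm_ge.
Qed.

HB.instance Definition _ :=
  Lmodule_isNormed.Build R CQ cfun_ler_normD cfun_normZ cfun_norm0_eq0.

Lemma cst_continuous_pred (a : R) : (fun _ : Q => a) \in continuous_pred.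
Proof. by rewrite inE => q; exact: cvg_cst. Qed.

Definition cfun_cst (a : R) : CQ := CFun cQ (cst_continuous_pred a).

Definition nonneg_cone : set CQ := [set x | forall q, 0 <= x q].

End ContinuousFunctions.

(* Continuous linear maps between normed spaces, with the operator norm. *)
Section ContinuousLinearMaps.
Context {R : realType}.
Variables E F : normedModType R.

Definition clin_pred : {pred E -> F} :=
  mem [set f : E -> F | linear f /\ continuous f].

Record clin := CLin { clin_val :> E -> F; clin_valP : clin_val \in clin_pred }.

HB.instance Definition _ := [isSub of clin for clin_val].
HB.instance Definition _ := [Choice of clin by <:].

Lemma clin_submod_closed : submod_closed clin_pred.
Proof.
split.
  rewrite inE; split; last by move=> x; exact: cvg_cst.
  by move=> a x y; rewrite /= scaler0 addr0.
move=> a f g; rewrite !inE => -[lf cf] [lg cg]; split.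
  move=> b x y; rewrite !fctE /= lf lg !scalerDr !scalerA (mulrC a b).
  by rewrite addrACA.
by move=> x; apply: cvgD; [apply: cvgZl_tmp; exact: cf | exact: cg].
Qed.

HB.instance Definition _ := GRing.isSubmodClosed.Build R (E -> F)
  clin_pred clin_submod_closed.
HB.instance Definition _ := [SubChoice_isSubLmodule of clin by <:].

Lemma clin_linear (f : clin) : linear f.
Proof. by have := clin_valP f; rewrite inE => -[]. Qed.

HB.instance Definition _ (f : clin) :=
  GRing.isLinear.Build R E F _ f (clin_linear f).

Lemma clin_continuous (f : clin) : continuous f.
Proof. by have := clin_valP f; rewrite inE => -[]. Qed.

Lemma clinP (f g : clin) : (forall x, f x = g x) -> f = g.
Proof. by move=> fg; apply/val_inj/funext. Qed.

Definition opnorm (f : clin) : R :=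
  sup [set `|f x| | x in [set x | `|x| <= 1]].

Lemma opnorm_has_ubound (f : clin) :
  has_ubound [set `|f x| | x in [set x | `|x| <= 1]].
Proof.
have /linear_bounded_continuous/bounded_funP/(_ 1)[M fM] := @clin_continuous f.
by exists M => _ [x x1 <-]; exact: fM.
Qed.

Lemma opnorm_ge_unit (f : clin) x : `|x| <= 1 -> `|f x| <= opnorm f.
Proof. by move=> x1; apply: ub_le_sup; [exact: opnorm_has_ubound|exists x]. Qed.

Lemma opnorm_ge0 (f : clin) : 0 <= opnorm f.
Proof. by rewrite (le_trans _ (@opnorm_ge_unit f 0 _)) ?normr0. Qed.

Lemma opnorm_ge (f : clin) x : `|f x| <= opnorm f * `|x|.
Proof.
have [->|x0] := eqVneq x 0; first by rewrite linear0 !normr0 mulr0.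
rewrite -ler_pdivrMr ?normr_gt0// mulrC.
rewrite -{1}[`|x|]normr_id -normfV -normrZ -linearZ opnorm_ge_unit//.
by rewrite normrZ normfV normr_id mulVf ?normr_eq0.
Qed.

Lemma opnorm_le (f : clin) (M : R) :
  0 <= M -> (forall x, `|f x| <= M * `|x|) -> opnorm f <= M.
Proof.
move=> M0 fM; apply: ge_sup.
  by exists `|f 0|, 0 => //=; rewrite normr0.
by move=> _ [x /= x1 <-]; rewrite (le_trans (fM x))// ler_piMr.
Qed.

Lemma opnorm_ler_normD (f g : clin) : opnorm (f + g) <= opnorm f + opnorm g.
Proof.
apply: opnorm_le => [|x]; first by rewrite addr_ge0 ?opnorm_ge0.
by rewrite (le_trans (ler_normD _ _))// mulrDl lerD ?opnorm_ge.
Qed.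

Lemma opnormZ (a : R) (f : clin) : opnorm (a *: f) = `|a| * opnorm f.
Proof.
have le b g : opnorm (b *: g) <= `|b| * opnorm g.
  apply: opnorm_le => [|x]; first by rewrite mulr_ge0 ?opnorm_ge0.
  by rewrite [X in `|X|]/(b *: g x) normrZ -mulrA ler_wpM2l ?opnorm_ge.
apply/eqP; rewrite eq_le le/=; have [->|a0] := eqVneq a 0.
  by rewrite normr0 mul0r opnorm_ge0.
by have := le a^-1 (a *: f); rewrite scalerK// normfV ler_pdivlMl ?normr_gt0.
Qed.

Lemma opnorm0_eq0 (f : clin) : opnorm f = 0 -> f = 0.
Proof.
move=> f0; apply: clinP => x; apply/eqP; rewrite -normr_le0.
by have := opnorm_ge f x; rewrite f0 mul0r.
Qed.

HB.instance Definition _ :=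
  Lmodule_isNormed.Build R clin opnorm_ler_normD opnormZ opnorm0_eq0.

End ContinuousLinearMaps.

Arguments clin_pred {R} E F _.

Notation dual E := (clin E (GRing.regular _)).

Section Operators.
Context {R : realType}.

Lemma clin_id_subproof (E : normedModType R) : idfun \in clin_pred E E.
Proof. by rewrite inE; split => // x; exact: cvg_id. Qed.

Definition clin_id (E : normedModType R) : clin E E :=
  CLin (clin_id_subproof E).

Lemma clin_comp_subproof (E F G : normedModType R) (g : clin F G)
  (f : clin E F) : (fun x => g (f x)) \in clin_pred E G.
Proof.
rewrite inE; split; first by move=> a x y; rewrite !linearP.
by move=> x; apply: continuous_comp; exact: clin_continuous.
Qed.

Definition clin_comp (E F G : normedModType R) (g : clin F G) (f : clin E F) :
  clin E G := CLin (clin_comp_subproof g f).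

Definition clin_pow (E : normedModType R) (A : clin E E) (n : nat) :
  clin E E := iter n (clin_comp A) (clin_id E).

Lemma adjoint_subproof (E F : normedModType R) (A : clin E F) :
  (fun f : dual F => clin_comp f A : dual E) \in clin_pred (dual F) (dual E).
Proof.
rewrite inE; have la : linear (fun f : dual F => clin_comp f A : dual E).
  by move=> a f g; apply: clinP => x.
split=> //.
pose T := GRing.isLinear.Build R (dual F) (dual E) _ _ la.
pose L : {linear dual F -> dual E} :=
  HB.pack (fun f : dual F => clin_comp f A : dual E) T.
apply/(@linear_bounded_continuous _ _ _ L)/bounded_funP => r.
exists (r * `|A|) => f fr; apply: opnorm_le => [|x].
  by rewrite mulr_ge0// (le_trans _ fr).
rewrite (le_trans (opnorm_ge f _))// -mulrA ler_pM ?opnorm_ge0//.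
exact: opnorm_ge.
Qed.

Definition adjoint (E F : normedModType R) (A : clin E F) :
  clin (dual F) (dual E) := CLin (adjoint_subproof A).

Lemma rank_one_subproof (E : normedModType R) (f : dual E) (u : E) :
  (fun x => f x *: u) \in clin_pred E E.
Proof.
rewrite inE; split; first by move=> a x y; rewrite linearP scalerDl scalerA.
by move=> x; apply: cvgZr_tmp; exact: clin_continuous.
Qed.

Definition rank_one (E : normedModType R) (f : dual E) (u : E) : clin E E :=
  CLin (rank_one_subproof f u).

(* sigma(E, E^* ): the initial topology of the canonical map from E to the
   functions on E^* with the topology of pointwise convergence. *)
Definition weak (E : normedModType R) : topologicalType :=
  initial_topology (fun (x : E) => (fun f : dual E => f x) : {ptws dual E -> R}).

(* sigma(E^*, E) *)
Definition weak_star (E : normedModType R) : topologicalType :=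
  initial_topology (fun (f : dual E) => (f : E -> R) : {ptws E -> R}).

(* In the library [precompact] means relatively compact. *)
Definition compact_operator (E F : normedModType R) (A : clin E F) : Prop :=
  precompact [set A x | x in [set x | `|x| <= 1]].

Definition weakly_compact_operator (E F : normedModType R) (A : clin E F) :
  Prop := precompact ([set A x | x in [set x | `|x| <= 1]] : set (weak F)).

Definition eigenspace_of (E : normedModType R) (A : clin E E) (l : R) :
  set E := [set x | A x = l *: x].

Definition simple_eigenvalue (E : normedModType R) (A : clin E E) (l : R) :
  Prop :=
  exists2 x : E, x != 0 & eigenspace_of A l = [set c *: x | c in [set: R]].

End Operators.

Section MarkovOperators.
Context {R : realType} {Q : topologicalType} {cQ : compact [set: Q]}.
Local Notation CQ := (@cfun R Q cQ).

Definition markov_operator (A : clin CQ CQ) : Prop :=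
  (forall x, nonneg_cone x -> nonneg_cone (A x)) /\ A (cfun_cst cQ 1) = cfun_cst cQ 1.

Definition positive_functional (f : dual CQ) : Prop :=
  forall x, nonneg_cone x -> 0 <= f x.

Definition probability_functional (mu : dual CQ) : Prop :=
  positive_functional mu /\ mu (cfun_cst cQ 1) = 1.

Definition regularity_condition (A : clin CQ CQ) : Prop :=
  exists2 m : nat, (0 < m)%N &
    forall x : CQ, nonneg_cone x -> x != 0 -> forall q, 0 < clin_pow A m x q.

End MarkovOperators.

(* Main.v *)
Require Import Defs.
From HB Require Import structures.
From mathcomp Require Import all_boot all_order all_algebra.
From mathcomp Require Import all_classical all_reals all_analysis.
From mathcomp Require Import lra ring.
Import Order.TTheory GRing.Theory Num.Theory.
Import numFieldNormedType.Exports.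
Local Open Scope classical_set_scope.
Local Open Scope ring_scope.

Set Implicit Arguments.
Unset Strict Implicit.
Unset Printing Implicit Defensive.

(** Two independent arguments are combined.

    Compactness of a power.  If A is weakly compact, then A^2 is compact.  For
    a general operator this is the Dunford-Pettis property of C(Q); positivity
    gives it without representing functionals by measures.  Let W be the weak
    closure of the image of the unit ball, a weakly compact set.  First, if
    0 <= z_n <= 1 tends to 0 pointwise, then A z_n tends to 0 uniformly
    ([markov_null_sequence]).  The continuous functions A (max_{n <= k < n + m} z_k)
    lie in W and increase with m, so a weak cluster point g_n is their pointwise
    supremum, and it is again continuous.  The g_n decrease; they tend to 0
    pointwise by the Daniell form of dominated convergence ([daniell]), hence
    uniformly by Dini's theorem, and they dominate A z_n.  Next, A is continuous
    from the weak to the norm topology on W ([markov_completely_continuous]):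
    otherwise, as in the theorem of Eberlein, there is a sequence in W tending
    pointwise to y along which A stays away from A y, and the absolute
    differences contradict the first step.  So A maps W onto a norm compact set,
    which contains the image of the unit ball under A^2.

    Convergence.  Let A^k be compact and A^m strictly positive.  The closure K of
    the image under A^k of the functions with values in [0, 1] is compact.  For
    y in K the function A^m y has oscillation less than 1, as it is either zero or
    bounded below by a positive constant; by compactness the oscillation is at
    most some c < 1 on all of K ([regular_oscillation]).  As A preserves
    constants, A^(m + k) multiplies the oscillation of every function by at most
    c, so A^n x tends to a constant f0 x, uniformly for x in the unit ball
    ([limit_functional]).  Hence A^n tends in norm to the rank one operator
    taking x to the constant function f0 x, that is, u is the constant 1, and every remaining claim is read off from this limit.
    Strict positivity of f0, for instance, holds because f0 x = f0 (A^m x) and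
    A^m x is bounded below by a positive constant. *)

(** * Continuous functions on a compact space *)

Section Cfun.
Context {R : realType} {Q : topologicalType} {cQ : compact [set: Q]}.
Local Notation CQ := (@cfun R Q cQ).
Implicit Types (x y : CQ) (q : Q).

Lemma cfunBE x y q : (x - y) q = x q - y q. Proof. by []. Qed.
Lemma cfunNE x q : (- x) q = - x q. Proof. by []. Qed.
Lemma cfunZE a x q : (a *: x) q = a * x q. Proof. by []. Qed.

Lemma cfun_le_norm x q : `|x q| <= `|x|.
Proof. exact: cfun_norm_ge. Qed.

Lemma norm_cfun_le x M : 0 <= M -> (forall q, `|x q| <= M) -> `|x| <= M.
Proof. exact: cfun_norm_le. Qed.

Definition cfun_max x y : CQ.
Proof.
by apply: (@CFun _ _ _ (fun q => Num.max (x q) (y q))); rewrite inE => q;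
  apply: continuous_max; exact: cfun_continuous.
Defined.

Definition cfun_min x y : CQ.
Proof.
by apply: (@CFun _ _ _ (fun q => Num.min (x q) (y q))); rewrite inE => q;
  apply: continuous_min; exact: cfun_continuous.
Defined.

Definition cfun_abs x : CQ.
Proof.
by apply: (@CFun _ _ _ (fun q => `|x q|)); rewrite inE => q;
  apply: cvg_norm; exact: cfun_continuous.
Defined.

Lemma cfun_absE x q : cfun_abs x q = `|x q|. Proof. by []. Qed.

Lemma contractive_clin_pred (f : CQ -> R^o) :
  linear f -> (forall x, `|f x| <= `|x|) -> f \in clin_pred CQ R^o.
Proof.
move=> lf f1; rewrite inE; split=> //.
pose L : {linear CQ -> R^o} :=
  HB.pack f (GRing.isLinear.Build R CQ R^o _ _ lf).
apply/(@linear_bounded_continuous _ _ _ L)/bounded_funP => r.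
by exists r => x xr; rewrite (le_trans _ xr).
Qed.

Lemma cfun_eval_subproof q : (fun x => x q) \in clin_pred CQ R^o.
Proof.
by apply: contractive_clin_pred => [//|x]; exact: cfun_le_norm.
Qed.

Definition cfun_eval q : dual CQ := CLin (cfun_eval_subproof q).

Lemma dini (v : nat -> CQ) :
  (forall n q, v n.+1 q <= v n q) ->
  (forall q e, 0 < e -> exists n, v n q < e) ->
  forall e, 0 < e -> exists n, forall q, v n q < e.
Proof.
move=> dv v0 e e0.
have vle n k q : v (n + k)%N q <= v n q.
  by elim: k => [|k IH]; rewrite ?addn0// addnS (le_trans (dv _ _)).
have := (compact_near_coveringP [set: Q]).1 cQ nat \oo
  (fun n q => v n q < e) _.
move=> /(_ _) [q _|N _ /(_ N (leqnn N)) vN]; last by exists N => q; exact: vN.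
have [n vn] := v0 q e e0.
have := @cfun_continuous _ _ _ (v n) q.
move=> /cvgr_lt /(_ _ vn) near_q.
exists ([set q' | v n q' < e], [set k | (n <= k)%N]).
  by split => //=; exists n.
move=> [q' k] /= [q'n nk].
by rewrite (le_lt_trans _ q'n)// -(subnKC nk).
Qed.

End Cfun.

(** * Probability functionals and the Daniell property *)

Section Daniell.
Context {R : realType} {Q : topologicalType} {cQ : compact [set: Q]}.
Local Notation CQ := (@cfun R Q cQ).
Implicit Types (x y : CQ) (q : Q) (z : nat -> CQ).

Lemma positive_mono (f : dual CQ) x y : positive_functional f ->
  (forall q, x q <= y q) -> f x <= f y.
Proof.
move=> f0 xy; have := f0 (y - x).
by rewrite linearB subr_ge0; apply => q; rewrite cfunBE subr_ge0.
Qed.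

Lemma probability_cst (f : dual CQ) (a : R) : probability_functional f ->
  f (cfun_cst cQ a) = a.
Proof.
move=> [_ f1]; have -> : cfun_cst cQ a = a *: cfun_cst cQ 1.
  by apply: cfunP => q; rewrite cfunZE mulr1.
by rewrite linearZ /= f1 /GRing.scale /= mulr1.
Qed.

Lemma probability_le (f : dual CQ) x (a : R) : probability_functional f ->
  (forall q, x q <= a) -> f x <= a.
Proof.
move=> pf xa; rewrite -[leRHS](probability_cst a pf).
by apply: positive_mono => //; case: pf.
Qed.

(** The maximum of 0 and of the m functions z_n, ..., z_{n + m - 1}. *)
Fixpoint block_max (z : nat -> CQ) (n m : nat) : CQ :=
  if m is m'.+1 then cfun_max (block_max z n m') (z (n + m')%N) else 0.

Lemma block_max_ge0 z n m q : 0 <= block_max z n m q.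
Proof. by elim: m => [|m IH] //=; rewrite le_max IH. Qed.

Lemma block_max_le z n m q (c : R) : 0 <= c ->
  (forall k, (n <= k < n + m)%N -> z k q <= c) -> block_max z n m q <= c.
Proof.
move=> c0; elim: m => [|m IH] //= zc; rewrite ge_max IH /=.
  by rewrite zc// leq_addr addnS /=.
by move=> k /andP[nk km]; rewrite zc// nk addnS ltnW.
Qed.

Lemma block_max_ge z n m q k : (n <= k < n + m)%N -> z k q <= block_max z n m q.
Proof.
elim: m => [|m IH] /=; first by rewrite addn0 ltnNge andbN.
rewrite addnS ltnS [(k <= _)%N]leq_eqVlt le_max => /andP[nk].
by case/orP => [/eqP ->|km]; rewrite ?lexx ?orbT// IH// nk.
Qed.

Lemma block_max_sub z n m i M q : (i <= n)%N -> (n + m <= i + M)%N ->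
  block_max z n m q <= block_max z i M q.
Proof.
move=> ni nmiM; apply: block_max_le; first exact: block_max_ge0.
move=> k /andP[nk km]; apply: block_max_ge.
by rewrite (leq_trans ni nk) (leq_trans km nmiM).
Qed.

(** The Daniell form of dominated convergence.  The suprema of the tails of z, the
    limits in m of [block_max z n m], decrease to 0 but need not be continuous, so
    Dini's theorem does not apply to them.  Instead, for each n a block is taken whose value nearly attains the
    supremum over m, and v_n is the minimum of the first n + 1 chosen blocks.  The
    v_n decrease to 0 pointwise, hence uniformly, and passing to minima loses only
    the sum of the chosen errors. *)
Lemma daniell (f : dual CQ) (z : nat -> CQ) : probability_functional f ->
  (forall n q, z n q <= 1) ->
  (forall q (e : R), 0 < e -> exists N, forall n, (N <= n)%N -> z n q <= e) ->
  forall e : R, 0 < e -> exists n, forall m, f (block_max z n m) <= e.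
Proof.
move=> pf z1 z0 e e0; have [f0 f1] := pf.
set W := block_max z.
have e20 : 0 < e / 2 by lra.
pose d n : R := e / 2 * 2^-1 ^+ n.
have d0 n : 0 < d n by rewrite mulr_gt0// exprn_gt0.
have [M HM] : exists M : nat -> nat, forall n m', f (W n m') <= f (W n (M n)) + d n.+1.
  suff H n : exists m, forall m', f (W n m') <= f (W n m) + d n.+1.
    by exists (fun n => sval (cid (H n))) => n; exact: svalP (cid (H n)).
  have hs : has_sup (range (fun m => f (W n m) : R)).
    split; first by exists (f (W n 0%N)); exists 0%N.
    exists 1 => _ [m _ <-]; apply: probability_le => // q.
    by apply: block_max_le => // k _; exact: z1.
  have [_ [m _ <-] Hm] := sup_adherent (d0 n.+1) hs.
  exists m => m'; rewrite -lerBlDr; apply: le_trans (ltW Hm).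
  by rewrite lerD2r; apply: ub_le_sup; [case: hs|exists m'].
pose v := fix v n := if n is n'.+1 then cfun_min (v n') (W n (M n)) else W 0%N (M 0%N).
have vW n q : v n q <= W n (M n) q by case: n => [|n] //=; rewrite ge_min lexx orbT.
(* The choice of W i (M i) loses at most d i.+1, and the d i.+1 with i < n sum
   to e / 2 - d n. *)
have key n : f (W n (M n)) - f (v n) <= e / 2 - d n.
  elim: n => [|n IH]; first by rewrite /= subrr /d expr0 mulr1 subrr.
  (* L is so long that the block W n L contains both W n (M n) and
     W n.+1 (M n.+1). *)
  set L := (maxn (M n) (M n.+1).+1).
  have h1 : f (W n.+1 (M n.+1) - v n.+1) <= f (W n L - v n).
    apply: positive_mono => // q; rewrite !cfunBE /=.
    have a1 : W n.+1 (M n.+1) q <= W n L q.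
      by apply: block_max_sub; rewrite // addSn -addnS leq_add2l leq_maxr.
    have a2 : v n q <= W n L q.
      by apply: le_trans (vW n q) _; apply: block_max_sub; rewrite // leq_add2l leq_maxl.
    by rewrite minEle; case: ifP => _; lra.
  have h2 := HM n L; move: h1; rewrite !linearB /=.
  have dS : d n = d n.+1 + d n.+1 by rewrite /d exprSr; lra.
  move: IH h2; rewrite dS; move: (f (W n.+1 _)) (f (v n.+1)) (f (W n (M n))) (f (v n)) (f (W n L)) (d n.+1).
  by rewrite /GRing.regular => *; lra.
have [n vn] : exists n, forall q, v n q < e / 2.
  apply: dini => // [n q|q c c0]; first by rewrite /= ge_min lexx.
  have [N HN] := z0 q (c / 2) ltac:(lra).
  exists N; apply: le_lt_trans (vW N q) _.
  apply: (@le_lt_trans _ _ (c / 2)); last lra.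
  by apply: block_max_le => [|k /andP[/HN]//]; lra.
exists n => m.
have h3 : f (v n) <= e / 2 by apply: probability_le => // q; exact: ltW.
have := key n; have := HM n m; move: h3.
have dS : d n = d n.+1 + d n.+1 by rewrite /d exprSr; lra.
have := d0 n.+1; rewrite dS.
move: (f (W n m)) (f (W n (M n))) (f (v n)) (d n.+1).
by rewrite /GRing.regular => *; lra.
Qed.

End Daniell.

(** * Null sequences under a weakly compact Markov operator *)

Section WeakCompact.
Context {R : realType} {Q : topologicalType} {cQ : compact [set: Q]}.
Local Notation CQ := (@cfun R Q cQ).
Implicit Types (x y : CQ) (q : Q) (z : nat -> CQ).

Lemma weak_eval_continuous (E : normedModType R) (f : dual E) :
  continuous ((fun x : E => f x : R) : weak E -> R).
Proof.
move=> x.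
have := @initial_continuous E {ptws dual E -> R} (fun (x : E) (f : dual E) => f x) x.
move=> c1.
have c2 := @proj_continuous (dual E) (fun=> R) f (fun f : dual E => f x).
exact: (continuous_comp c1 c2).
Qed.

(** The only weak neighbourhoods that matter below are those of pointwise
    convergence. *)
Lemma nbhs_weak_points y (s : seq Q) (e : R) : 0 < e ->
  nbhs (y : weak CQ) [set x : CQ | forall q, q \in s -> `|x q - y q| < e].
Proof.
move=> e0; elim: s => [|p s IH]; first by apply: filterS filterT.
have near_p : nbhs (y : weak CQ) [set x : CQ | `|x p - y p| < e].
  have /cvgr_dist_lt := @weak_eval_continuous CQ (cfun_eval p) y.
  by move=> /(_ e e0); apply: filterS => x /=; rewrite distrC.
apply: filterS2 near_p IH => x xp xs q; rewrite inE => /orP[/eqP->//|]; exact: xs.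
Qed.

Lemma weak_cluster_points (W : set CQ) (F : set_system nat) z :
  compact (W : set (weak CQ)) -> ProperFilter F -> (forall n, W (z n)) ->
  exists2 y, W y & forall P (s : seq Q) (e : R), F P -> 0 < e ->
    exists2 n, P n & forall q, q \in s -> `|z n q - y q| < e.
Proof.
move=> cW PF zW.
have [|y [Wy clF]] := cW (z @ F) _.
  exact: (@filterS _ F _ setT _ (fun n _ => zW n) filterT).
exists y => // P s e FP e0.
have FzP : (z @ F) (z @` P).
  by apply: (@filterS _ F _ P) FP => n Pn; exists n.
by have [_ [[n Pn <-] Hn]] := clF _ _ FzP (nbhs_weak_points y s e0); exists n.
Qed.

Section Markov.
Variable A : clin CQ CQ.
Hypothesis mA : markov_operator A.

Lemma markov_mono x y : (forall q, x q <= y q) -> forall q, A x q <= A y q.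
Proof.
move=> xy q; have := mA.1 (y - x) _ q.
by rewrite linearB cfunBE subr_ge0; apply => p; rewrite cfunBE subr_ge0.
Qed.

Lemma markov_probability q : probability_functional (adjoint A (cfun_eval q)).
Proof.
split=> [x x0|] /=; first exact: mA.1.
by rewrite mA.2.
Qed.

Lemma markov_abs x q : `|A x q| <= A (cfun_abs x) q.
Proof.
rewrite ler_norml -cfunNE -linearN; apply/andP; split; apply: markov_mono => p.
  by rewrite cfunNE /= lerNl -normrN ler_norm.
exact: ler_norm.
Qed.

(** Weak compactness is what makes the suprema over m of A (block_max z n m)
    continuous: a weak cluster point g n of this increasing sequence is its
    pointwise supremum.  The g n decrease in n, tend to 0 pointwise by [daniell],
    and so tend to 0 uniformly; moreover A (z n) <= g n. *)
Lemma markov_null_sequence (W : set CQ) z : compact (W : set (weak CQ)) ->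
  (forall x, `|x| <= 1 -> W (A x)) ->
  (forall n q, 0 <= z n q <= 1) ->
  (forall q (e : R), 0 < e -> exists N, forall n, (N <= n)%N -> z n q <= e) ->
  forall e : R, 0 < e -> exists n, forall q, A (z n) q < e.
Proof.
move=> cW AW z01 z0 e e0.
have z1 n q : z n q <= 1 by case/andP: (z01 n q).
have WA n m : W (A (block_max z n m)).
  apply/AW/norm_cfun_le => // q; rewrite ger0_norm ?block_max_ge0//.
  by apply: block_max_le => // k _.
have /choice[g Hg] n : exists g : CQ, forall q,
    (forall m, A (block_max z n m) q <= g q) /\
    (forall c, (forall m, A (block_max z n m) q <= c) -> g q <= c).
  have [g _ Hg] := weak_cluster_points (F := \oo) cW _ (WA n).
  exists g => q; split=> [m|c Hc]; apply/ler_addgt0Pr => d d0.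
    have [k /= mk /(_ q)] := Hg _ [:: q] d (nbhs_infty_ge m) d0.
    rewrite mem_seq1 eqxx => /(_ isT); rewrite ltr_norml => /andP[_ kd].
    have : A (block_max z n m) q <= A (block_max z n k) q.
      by apply: markov_mono => p; apply: block_max_sub; rewrite // leq_add2l.
    lra.
  have [k _ /(_ q)] := Hg setT [:: q] d filterT d0.
  rewrite mem_seq1 eqxx => /(_ isT); rewrite ltr_norml => /andP[kd _].
  have := Hc k; lra.
have [|q c c0|n gn] := @dini _ _ _ g _ _ e e0.
- move=> n q; apply: (Hg n.+1 q).2 => m; apply: le_trans ((Hg n q).1 m.+1).
  by apply: markov_mono => p; apply: block_max_sub; rewrite // addSn addnS.
- have c20 : 0 < c / 2 by lra.
  have [n Hn] := daniell (markov_probability q) z1 z0 c20.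
  exists n; apply: (@le_lt_trans _ _ (c / 2)); last lra.
  exact: (Hg n q).2.
exists n => q; apply: le_lt_trans (gn q); apply: le_trans ((Hg n q).1 1%N).
by apply: markov_mono => p; apply: block_max_ge; rewrite leqnn addn1 ltnSn.
Qed.

End Markov.
End WeakCompact.

(** * The square of a weakly compact Markov operator is compact *)

Section Eberlein.
Context {R : realType} {Q : topologicalType} {cQ : compact [set: Q]}.
Local Notation CQ := (@cfun R Q cQ).
Implicit Types (x y : CQ) (q : Q) (z : nat -> CQ).

(** A finite family of continuous functions on a compact space is totally
    bounded for the pseudometric that it defines, although Q need not be
    metrizable. *)
Lemma finite_net (h : seq CQ) (e : R) : 0 < e ->
  exists t : seq Q, forall q, exists2 p, p \in t &
    forall x, x \in h -> `|x p - x q| <= e.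
Proof.
move=> e0.
(* Finite sets of points directed by inclusion: along this filter compactness
   makes the local nets into one that serves all of Q. *)
pose F := filter_from setT (fun t : seq Q => [set t' : seq Q | {subset t <= t'}]).
have FF : ProperFilter F.
  apply: filter_from_proper => [|t _]; last by exists t => /=.
  apply: filter_from_filter => [|t1 t2 _ _]; first by exists [::].
  exists (t1 ++ t2) => // t /= tt; split=> p pt; apply: tt.
    by rewrite mem_cat pt.
  by rewrite mem_cat pt orbT.
pose P (t : seq Q) q := exists2 p, p \in t & forall x, x \in h -> `|x p - x q| <= e.
have H : \forall t \near F, [set: Q] `<=` P t.
  apply: ((compact_near_coveringP [set: Q]).1 cQ (seq Q) F P) => q _.
  have nq : \forall q' \near q, forall x, x \in h -> `|x q - x q'| <= e.
    elim: h {P} => [|x h IH]; first by apply: filterS filterT.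
    have /cvgr_dist_le /(_ e e0) nx := @cfun_continuous _ _ _ x q.
    by apply: filterS2 nx IH => q' h1 h2 x'; rewrite inE => /orP[/eqP->//|/h2].
  exists ([set q' | forall x, x \in h -> `|x q - x q'| <= e], [set t : seq Q | q \in t]).
    by split => //=; exists [:: q] => // t /= -> //; rewrite mem_seq1.
  by move=> [q' t] /= [h1 h2]; exists q.
by have [t Ht] := filter_ex H; exists t => q; exact: Ht.
Qed.

Lemma cluster_value (p : nat -> Q) q x (l : R) : cluster (p @ \oo) q ->
  (forall d, 0 < d -> \forall n \near \oo, `|x (p n) - l| <= d) -> x q = l.
Proof.
move=> clq Hx; apply/eqP; rewrite -subr_eq0 -normr_le0; apply/ler_addgt0Pr => e e0.
have e20 : 0 < e / 2 by lra.
have /cvgr_dist_le /(_ _ e20) nx := @cfun_continuous _ _ _ x q.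
have pP : (p @ \oo) [set q' | `|x q' - l| <= e / 2] by exact: Hx.
have [q' [/= h1 h2]] := clq _ _ pP nx.
by rewrite add0r; have := ler_distD (x q') (x q) l; lra.
Qed.

(** In topological terms, A is weak-to-norm continuous on W.  If this fails at y,
    points x_n of W with |A x_n - A y| > e somewhere are chosen one after another
    such that x_n is close to y on finite nets adapted to y and to x_0, ...,
    x_{n-1}.  Any weak cluster point y' of a subsequence agrees with y on the union
    D of the nets.  It agrees with y everywhere: each q has a companion q' in the
    closure of D at which y and all x_n take the same values as at q, and then
    so does y'.  Hence x_n tends to y pointwise, and |x_n - y| / 2 contradicts
    [markov_null_sequence]. *)
Lemma markov_completely_continuous (A : clin CQ CQ) (W : set CQ) y (e : R) :
  markov_operator A -> compact (W : set (weak CQ)) ->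
  (forall x, `|x| <= 1 -> W (A x)) ->
  (forall x, W x -> forall q, `|x q| <= 1) -> W y -> 0 < e ->
  exists s : seq Q, exists2 d : R, 0 < d & forall x, W x ->
    (forall q, q \in s -> `|x q - y q| < d) -> forall q, `|A x q - A y q| <= e.
Proof.
move=> mA cW AW W1 Wy e0; apply: contrapT => Hn.
have Hbad (s : seq Q) (d : R) : 0 < d -> exists x,
    [/\ W x, forall q, q \in s -> `|x q - y q| < d & exists q, e < `|A x q - A y q|].
  move=> d0; apply: contrapT => Hx; apply: Hn; exists s; exists d => // x Wx xs q.
  by rewrite leNgt; apply/negP => lt; apply: Hx; exists x; split=> //; exists q.
have inv0 n : 0 < n.+1%:R^-1 :> R by rewrite invr_gt0 ltr0n.
have /choice[net netP] (h : seq CQ) := finite_net (y :: h) (inv0 (size h)).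
(* nets h accumulates the nets of all earlier stages of the history h, so that
   the approximation on a net persists at every later stage. *)
pose nets := fix nets h := net h ++ (if h is _ :: h' then nets h' else [::]).
have net_nets h p : p \in net h -> p \in nets h by case: h => [|? ?] ph; rewrite mem_cat ph.
have /choice[pick pickP] (h : seq CQ) := Hbad (nets h) _ (inv0 (size h)).
pose hist n := iter n (fun h => pick h :: h) [::].
pose x n := pick (hist n).
have size_hist n : size (hist n) = n by elim: n => //= n ->.
have Wx n : W (x n) by case: (pickP (hist n)).
have xnet n p : p \in nets (hist n) -> `|x n p - y p| < n.+1%:R^-1.
  by case: (pickP (hist n)) => _; rewrite size_hist => H _ /H.
have nets_mono n N p : (n <= N)%N -> p \in nets (hist n) -> p \in nets (hist N).
  move=> /subnKC <- pn; elim: (N - n)%N => [|k IH]; first by rewrite addn0.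
  by rewrite addnS /= mem_cat IH orbT.
have x_hist i n : (i < n)%N -> x i \in hist n.
  elim: n => // n IH; rewrite ltnS leq_eqVlt => /orP[/eqP->|/IH xi].
    by rewrite /= inE eqxx.
  by rewrite /= inE xi orbT.
have small (d : R) : 0 < d -> \forall n \near \oo, n.+1%:R^-1 <= d.
  by move=> d0; apply: filterS (near_infty_natSinv_lt (PosNum d0)) => n; exact: ltW.
have xy q (c : R) : 0 < c -> exists N, forall n, (N <= n)%N -> `|x n q - y q| <= c.
  move=> c0; apply: contrapT => Hc.
  pose B := [set n | c < `|x n q - y q|].
  have PB : ProperFilter (within B \oo).
    split; last exact: within_filter.
    rewrite /within /= => -[N _ HN]; apply: Hc; exists N => n Nn.
    by rewrite leNgt; apply/negP; exact: HN.
  have [y' Wy' Hy'] := weak_cluster_points cW PB Wx.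
  have within_oo (P : set nat) : (\forall n \near \oo, P n) -> within B \oo P.
    by apply: filterS => n Pn _.
  have eq_net N p : p \in nets (hist N) -> y' p = y p.
    move=> pN; apply/eqP; rewrite -subr_eq0 -normr_le0; apply/ler_addgt0Pr => d d0.
    have d20 : 0 < d / 2 by lra.
    have [n [Nn nd] /(_ p)] := Hy' _ [:: p] _ (within_oo _ (filterI (nbhs_infty_ge N) (small _ d20))) d20.
    rewrite mem_seq1 eqxx distrC => /(_ isT) h1.
    have := lt_le_trans (xnet _ _ (nets_mono _ _ _ Nn pN)) nd => h2.
    by have := ler_distD (x n p) (y' p) (y p); lra.
  have /choice[p pP] N : exists p, p \in nets (hist N) /\
      forall w, w \in y :: hist N -> `|w p - w q| <= N.+1%:R^-1.
    have [p pn Hp] := netP (hist N) q; exists p; split; first exact: net_nets.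
    by move=> w /Hp; rewrite size_hist.
  (* q' is the companion of q. *)
  have [q' [_ clq']] := @cQ (p @ \oo) _ filterT.
  have yq' : y q' = y q.
    apply: cluster_value clq' _ => d /small; apply: filterS => n /(le_trans _); apply.
    by apply: (pP n).2; rewrite inE eqxx.
  have xq' i : x i q' = x i q.
    apply: cluster_value clq' _ => d /small; apply: filterS2 (nbhs_infty_gt i) => n ni.
    move=> /(le_trans _); apply.
    by apply: (pP n).2; rewrite inE x_hist ?orbT.
  have y'q' : y' q' = y q'.
    apply/eqP; rewrite -subr_eq0 -cfunBE; apply/eqP.
    apply: cluster_value clq' _ => d d0; apply: filterS filterT => n _.
    by rewrite cfunBE (eq_net n) ?subrr ?normr0 ?ltW//; exact: (pP n).1.
  have y'q : y' q = y q.
    rewrite -yq' -y'q'; apply/eqP; rewrite -subr_eq0 -normr_le0.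
    apply/ler_addgt0Pr => d d0; have d20 : 0 < d / 2 by lra.
    have [n _ Hs] := Hy' setT [:: q; q'] _ filterT d20.
    have h1 : `|x n q - y' q'| < d / 2 by rewrite -(xq' n) Hs// !inE eqxx orbT.
    have h2 : `|y' q - x n q| < d / 2 by rewrite distrC Hs// inE eqxx.
    by have := ler_distD (x n q) (y' q) (y' q'); lra.
  have [n] := Hy' B [:: q] c (withinT _ _) c0.
  rewrite /B /= => h1 /(_ q); rewrite mem_seq1 eqxx y'q => /(_ isT) h2.
  by move: h1; rewrite ltNge ltW.
pose z n := 2^-1 *: cfun_abs (x n - y).
have z01 n q : 0 <= z n q <= 1.
  rewrite /z cfunZE cfun_absE cfunBE.
  have := ler_normB (x n q) (y q); have := W1 _ (Wx n) q; have := W1 _ Wy q.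
  have := normr_ge0 (x n q - y q); lra.
have z0 q (c : R) : 0 < c -> exists N, forall n, (N <= n)%N -> z n q <= c.
  move=> c0; have [N HN] := xy q c c0; exists N => n /HN.
  rewrite /z cfunZE cfun_absE cfunBE; have := normr_ge0 (x n q - y q); lra.
have e20 : 0 < e / 2 by lra.
have [n Hz] := markov_null_sequence mA cW AW z01 z0 e20.
have [_ _ [q]] := pickP (hist n); rewrite -/(x n) ltNge => /negP; apply.
have := markov_abs mA (x n - y) q; rewrite linearB cfunBE => /le_trans; apply.
have := Hz q; rewrite /z linearZ cfunZE; lra.
Qed.

(** The weak closure W of the image of the unit ball is weakly compact, so its
    image under A is norm compact. *)
Lemma weakly_compact_markov_sqr (A : clin CQ CQ) : markov_operator A ->
  weakly_compact_operator A -> compact_operator (clin_pow A 2).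
Proof.
move=> mA; rewrite /weakly_compact_operator precompactE.
set B := [set A x | x in _]; pose W : set (weak CQ) := closure (B : set (weak CQ)).
rewrite -/W => cW.
have AW x : `|x| <= 1 -> W (A x) by move=> x1; apply: subset_closure; exists x.
have B1 x : B x -> forall q, `|x q| <= 1.
  move=> [w /= w1 <-] q; apply: le_trans (markov_abs mA w q) _.
  apply: probability_le (markov_probability mA q) _ => p /=.
  exact: le_trans (cfun_le_norm _ _) w1.
have W1 x : W x -> forall q, `|x q| <= 1.
  move=> Wx q; apply/ler_addgt0Pr => d d0.
  have [x' [/B1 /(_ q) h1 /(_ q)]] := Wx _ (nbhs_weak_points x [:: q] d0).
  rewrite mem_seq1 eqxx => /(_ isT); have := ler_distD 0 (x q) (x' q).
  by have := lerB_dist (x q) (x' q); rewrite [`|x' q - _|]distrC; lra.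
exists (A @` W); first by move=> _ [x /= x1 <-]; exists (A x) => //; exact: AW.
suff cAW : compact (A @` W) by split => //; apply: compact_closed => //; exact: norm_hausdorff.
apply: (@continuous_compact (weak CQ) CQ A W) => //.
rewrite continuous_subspace_in => y /set_mem Wy.
apply/cvgrPdist_le => e e0.
have [s [d d0 Hs]] := markov_completely_continuous mA cW AW W1 Wy e0.
rewrite /prop_near1 -nbhs_subspace_in//.
have := nbhs_weak_points y s d0; apply: filterS => x xs Wx /=.
apply: norm_cfun_le; first exact: ltW.
by move=> q; rewrite cfunBE distrC; exact: Hs.
Qed.

End Eberlein.

(** * Regularity contracts the oscillation *)

Lemma clin_powSE (R : realType) (E : normedModType R) (A : clin E E) n x :
  clin_pow A n.+1 x = A (clin_pow A n x).
Proof. by []. Qed.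

Lemma clin_powD (R : realType) (E : normedModType R) (A : clin E E) m n x :
  clin_pow A (m + n) x = clin_pow A m (clin_pow A n x).
Proof. by elim: m => [|m IH] //; rewrite addSn !clin_powSE IH. Qed.

Lemma clinB (R : realType) (E F : normedModType R) (f : clin E F) x y :
  f (x - y) = f x - f y.
Proof. exact: linearB. Qed.

Lemma clinZ (R : realType) (E F : normedModType R) (f : clin E F) a x :
  f (a *: x) = a *: f x.
Proof. exact: linearZ. Qed.

Section Contraction.
Context {R : realType} {Q : topologicalType} {cQ : compact [set: Q]}.
Local Notation CQ := (@cfun R Q cQ).
Implicit Types (x y : CQ) (q : Q) (z : nat -> CQ).
Local Notation one := (cfun_cst cQ (1 : R)).

Lemma markov_pow (A : clin CQ CQ) n : markov_operator A -> markov_operator (clin_pow A n).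
Proof.
move=> mA; elim: n => [|n [IH0 IH1]]; first by split.
split=> [x x0|]; first by rewrite clin_powSE; apply: mA.1; exact: IH0.
by rewrite clin_powSE IH1 mA.2.
Qed.

Lemma markov_cst (A : clin CQ CQ) (a : R) : markov_operator A ->
  A (cfun_cst cQ a) = cfun_cst cQ a.
Proof.
move=> mA; apply: cfunP => q; exact: (probability_cst a (markov_probability mA q)).
Qed.

Lemma markov_near_cst (A : clin CQ CQ) x (t r : R) : markov_operator A ->
  (forall q, `|x q - t| <= r) -> forall q, `|A x q - t| <= r.
Proof.
move=> mA xt q; rewrite -[X in `|_ - X|]/(cfun_cst cQ t q) -(markov_cst t mA).
rewrite -cfunBE -linearB; apply: le_trans (markov_abs mA _ q) _.
by apply: probability_le (markov_probability mA q) _ => p; exact: xt.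
Qed.

Lemma markov_norm_le (A : clin CQ CQ) x : markov_operator A -> `|A x| <= `|x|.
Proof.
move=> mA; apply: norm_cfun_le => // q; rewrite -[A x q]subr0.
by apply: markov_near_cst => // p; rewrite subr0; exact: cfun_le_norm.
Qed.

Hypothesis Q0 : [set: Q] !=set0.

Lemma strictly_positive_lower_bound x : (forall q, 0 < x q) ->
  exists2 d : R, 0 < d & forall q, d <= x q.
Proof.
move=> x0.
have cx : {within [set: Q], continuous x}.
  by apply: continuous_subspaceT; exact: cfun_continuous.
have [q _ Hq] := compact_EVT_min Q0 cQ cx.
by exists (x q) => // p; apply: Hq; rewrite in_setT.
Qed.

Section Regular.
Variables (A : clin CQ CQ) (k m : nat).
Hypothesis mA : markov_operator A.
Hypothesis cA : compact_operator (clin_pow A k).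
Hypothesis rA : forall x, nonneg_cone x -> x != 0 -> forall q, 0 < clin_pow A m x q.

Let mAm := markov_pow m mA.
Let mAk := markov_pow k mA.

(** The oscillation of a function w with values in [0, 1] is at most
    |w| + |1 - w| - 1.  The continuous function y |-> |A^m y| + |1 - A^m y| attains
    its maximum on the compact closure of the image under A^k of all such w, and
    there it is less than 2: A^m y is either zero or bounded below by a positive
    constant. *)
Lemma regular_oscillation : exists2 c : R, 0 <= c < 1 &
  forall x, (forall q, 0 <= x q <= 1) ->
    exists s : R, forall q, `|clin_pow A (m + k) x q - s| <= c / 2.
Proof.
have [q0 _] := Q0.
pose I := [set x : CQ | forall q, 0 <= x q <= 1].
have mI (B : clin CQ CQ) x : markov_operator B -> I x -> I (B x).
  move=> mB xI q; rewrite (mB.1 x _ q) /=; last by move=> p; case/andP: (xI p).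
  by apply: probability_le (markov_probability mB q) _ => p; case/andP: (xI p).
pose K := closure [set clin_pow A k x | x in I].
have cK : compact K.
  rewrite /K -precompactE; apply: precompact_subset cA => _ [x xI <-].
  exists x => //=; apply: norm_cfun_le => // q.
  by case/andP: (xI q) => x0 x1; rewrite ger0_norm.
have KI : K `<=` I.
  move=> y Ky q; have H (d : R) : 0 < d -> - d <= y q <= 1 + d.
    move=> d0; have [_ [[x xI <-] Hx]] := Ky _ (nbhsx_ballx y d d0).
    move: Hx; rewrite -ball_normE /= => Hx.
    have := le_lt_trans (cfun_le_norm (y - clin_pow A k x) q) Hx.
    rewrite cfunBE ltr_norml; have := mI _ _ mAk xI q; lra.
  apply/andP; split; apply/ler_addgt0Pr => d /H; lra.
pose h x : R := `|clin_pow A m x| + `|one - clin_pow A m x|.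
have ch : continuous h.
  move=> x; apply/(@cvgrPdist_le _ _ _ _ (nbhs_filter x)) => e e0.
  have e20 : 0 < e / 2 by lra.
  apply/nbhs_ballP; exists (e / 2) => // y; rewrite -ball_normE /= => xy.
  have /le_lt_trans/(_ xy) Axy := markov_norm_le (x - y) mAm.
  have := ler_dist_dist (clin_pow A m x) (clin_pow A m y).
  have := ler_dist_dist (one - clin_pow A m x) (one - clin_pow A m y).
  have -> : one - clin_pow A m x - (one - clin_pow A m y) = - clin_pow A m (x - y).
    by rewrite (linearB (clin_pow A m)) opprB addrC addrA subrK opprB.
  rewrite normrN -(linearB (clin_pow A m)) /h; move: Axy; rewrite !ler_norml; lra.
have hlt2 x : I x -> h x < 2.
  move=> xI; have [x0|x0] := eqVneq x 0.
    rewrite /h x0 linear0 normr0 subr0 add0r.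
    apply: (@le_lt_trans _ _ 1); last lra.
    by apply: norm_cfun_le => // q /=; rewrite normr1.
  have [|d d0 Hd] := strictly_positive_lower_bound (x := clin_pow A m x).
    by apply: rA => // q; case/andP: (xI q).
  have xmI := mI _ _ mAm xI.
  have d1 : d <= 1 by rewrite (le_trans (Hd q0))//; case/andP: (xmI q0).
  have h1 : `|clin_pow A m x| <= 1.
    by apply: norm_cfun_le => // q; case/andP: (xmI q) => ? ?; rewrite ger0_norm.
  have h2 : `|one - clin_pow A m x| <= 1 - d.
    apply: norm_cfun_le => [|q]; first lra.
    rewrite cfunBE; case/andP: (xmI q) => ? ?; rewrite ger0_norm /= ?subr_ge0//.
    by rewrite lerD2l lerN2.
  rewrite /h; lra.
have K0 : K !=set0.
  exists (clin_pow A k 0); apply: subset_closure; exists 0 => // q.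
  by rewrite [_ q]/(0 : R) lexx ler01.
have ch' : {within K, continuous h} by apply: continuous_subspaceT.
have [y /set_mem Ky Hy] := compact_EVT_max K0 cK ch'.
exists (h y - 1).
  have := hlt2 _ (KI _ Ky).
  have := le_trans (cfun_le_norm (clin_pow A m y + (one - clin_pow A m y)) q0) (ler_normD _ _).
  rewrite addrC subrK /= normr1 -/(h y); rewrite /h; lra.
move=> x xI; pose w := clin_pow A m (clin_pow A k x).
(* The midpoint of the interval from 1 - |1 - w| to |w|, which contains the
   values of w. *)
exists ((`|w| + 1 - `|one - w|) / 2) => q; rewrite clin_powD -/w.
have hw : h (clin_pow A k x) <= h y.
  by apply: Hy; rewrite inE; apply: subset_closure; exists x.
have := cfun_le_norm w q; have := cfun_le_norm (one - w) q.
rewrite cfunBE /= !ler_norml; move: hw; rewrite {1}/h -/w; lra.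
Qed.

(** The affine map taking [t - r, t + r] onto [0, 1] commutes with the Markov
    operator A^(m + k) and reduces this to [regular_oscillation]. *)
Lemma regular_contraction : exists2 c : R, 0 <= c < 1 &
  forall x (t r : R), (forall q, `|x q - t| <= r) ->
    exists s : R, forall q, `|clin_pow A (m + k) x q - s| <= c * r.
Proof.
have [c c01 Hc] := regular_oscillation; exists c => // x t r xt.
have [q0 _] := Q0; have r0 : 0 <= r := le_trans (normr_ge0 _) (xt q0).
have [r00|rn0] := eqVneq r 0.
  exists t => q; rewrite r00 mulr0 -r00.
  exact: markov_near_cst (markov_pow _ mA) _ _.
have {rn0}r0 : 0 < r by rewrite lt_def rn0.
pose x' := (2 * r)^-1 *: (x - cfun_cst cQ (t - r)).
have [|s Hs] := Hc x'.
  move=> q; rewrite cfunZE cfunBE /=; have := xt q; rewrite ler_norml => /andP[h1 h2].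
  rewrite mulr_ge0 ?invr_ge0 /=; [|lra|lra].
  rewrite mulrC ler_pdivrMr; lra.
exists (t - r + 2 * r * s) => q.
have := Hs q; rewrite clinZ clinB cfunZE cfunBE markov_cst /=; last exact: markov_pow.
set a := clin_pow A _ _ _; move=> h.
have -> : a - (t - r + 2 * r * s) = 2 * r * ((2 * r)^-1 * (a - (t - r)) - s).
  by field; rewrite lt0r_neq0//; lra.
rewrite normrM ger0_norm; last lra.
have := ler_wpM2l (_ : 0 <= 2 * r) h; move=> /(_ ltac:(lra)); lra.
Qed.

(** Iterating the contraction confines A^n x to geometrically shrinking intervals;
    later powers of A do not leave an interval that contains all the values. *)
Lemma uniform_stabilization (e : R) : 0 < e -> exists n0, forall x,
  exists t : R, forall n, (n0 <= n)%N -> forall q, `|clin_pow A n x q - t| <= e * `|x|.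
Proof.
move=> e0; have [c /andP[c0 c1] Hc] := regular_contraction.
have Hj j x : exists t : R, forall q, `|clin_pow A (j * (m + k)) x q - t| <= c ^+ j * `|x|.
  elim: j => [|j [t Ht]].
    by exists 0 => q; rewrite subr0 expr0 mul1r; exact: cfun_le_norm.
  have [s Hs] := Hc _ _ _ Ht; exists s => q.
  by rewrite mulSn clin_powD exprS -mulrA; exact: Hs.
have [j cj] : exists j, c ^+ j <= e.
  have /cvgr0Pnorm_le /(_ e e0) : (fun n => c ^+ n) @ \oo --> (0 : R).
    by apply: cvg_expr; rewrite ger0_norm.
  by move=> /filter_ex[j]; rewrite ger0_norm ?exprn_ge0//; exists j.
exists (j * (m + k))%N => x; have [t Ht] := Hj j x; exists t => n jn q.
rewrite -(subnK jn) clin_powD.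
apply: (markov_near_cst (markov_pow _ mA)) => p.
by rewrite (le_trans (Ht p))// ler_wpM2r.
Qed.

End Regular.
End Contraction.

(** * The limit functional and its consequences *)

Lemma weak_star_cvg (R : realType) (E : normedModType R) (u : nat -> dual E)
    (f : dual E) : (forall x, (u n x : R) @[n --> \oo] --> (f x : R)) ->
  (u n : weak_star E) @[n --> \oo] --> (f : weak_star E).
Proof.
move=> uf.
have uf' : ((fun x => u n x) : {ptws E -> R}) @[n --> \oo] --> ((fun x => f x : R) : {ptws E -> R}).
  apply/pointwise_cvgP => x; exact: uf.
move=> V [U [[B oB <-] Bf] UV].
have nB : nbhs ((fun x => f x : R) : {ptws E -> R}) B by exact: open_nbhs_nbhs.
by have := uf' _ nB; apply: (@filterS _ \oo) => n Bn; exact: UV.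
Qed.

Lemma clin_subE (R : realType) (E F : normedModType R) (f g : clin E F) x :
  (f - g) x = f x - g x.
Proof. by []. Qed.

Lemma adjointE (R : realType) (E F : normedModType R) (A : clin E F)
  (f : dual F) x : adjoint A f x = f (A x).
Proof. by []. Qed.

Lemma clin_pow_adjoint (R : realType) (E : normedModType R) (A : clin E E) n
    (f : dual E) x : clin_pow (adjoint A) n f x = f (clin_pow A n x).
Proof.
elim: n x => // n IH x; apply: etrans (IH (A x)) _.
by rewrite -[A x]/(clin_pow A 1 x) -clin_powD addn1.
Qed.

Section Limit.
Context {R : realType} {Q : topologicalType} {cQ : compact [set: Q]}.
Local Notation CQ := (@cfun R Q cQ).
Implicit Types (x y : CQ) (q : Q).
Local Notation one := (cfun_cst cQ (1 : R)).
Hypothesis Q0 : [set: Q] !=set0.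

Lemma cst_interior : interior (@nonneg_cone R Q cQ) one.
Proof.
apply/nbhs_ballP; exists 1 => [|x] //=; rewrite -ball_normE /= => x1 q.
have := le_lt_trans (cfun_le_norm (one - x) q) x1.
by rewrite cfunBE /= ltr_norml; lra.
Qed.

Lemma probability_norm (f : dual CQ) x : probability_functional f -> `|f x| <= `|x|.
Proof.
move=> pf; rewrite ler_norml -lerNl -linearN; apply/andP; split.
  apply: probability_le pf _ => q; rewrite cfunNE.
  by apply: le_trans (cfun_le_norm x q); rewrite -normrN ler_norm.
apply: probability_le pf _ => q; exact: le_trans (ler_norm _) (cfun_le_norm x q).
Qed.

(** The value of A^n x at any fixed point is a Cauchy sequence, and its limit does
    not depend on the point. *)
Lemma limit_functional (A : clin CQ CQ) : markov_operator A ->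
  (forall e : R, 0 < e -> exists n0, forall x, exists t : R,
     forall n, (n0 <= n)%N -> forall q, `|clin_pow A n x q - t| <= e * `|x|) ->
  exists2 f0 : dual CQ, probability_functional f0 &
    forall e : R, 0 < e -> exists n0, forall n, (n0 <= n)%N ->
      forall x, `|clin_pow A n x - f0 x *: one| <= e * `|x|.
Proof.
move=> mA stab; have [q0 _] := Q0.
pose u x n : R := clin_pow A n x q0.
have cu x : cvg (u x @ \oo).
  apply/cauchy_cvgP/cauchy_exP => e e0.
  have x1 : 0 < `|x| + 1 by rewrite ltr_wpDl.
  have [n0 /(_ x)[t Ht]] := stab _ (divr_gt0 e0 x1).
  exists t; exists n0 => // n /= nn; rewrite -ball_normE /= distrC.
  apply: le_lt_trans (Ht n nn q0) _.
  by rewrite mulrAC ltr_pdivrMr// ltr_pM2l// ltrDl.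
pose F x : R := lim (u x @ \oo).
have est (e : R) : 0 < e -> exists n0, forall n, (n0 <= n)%N -> forall x q,
    `|clin_pow A n x q - F x| <= e * `|x|.
  move=> e0; have e20 : 0 < e / 2 by lra.
  have [n0 Hn0] := stab _ e20; exists n0 => n nn x q; have [t Ht] := Hn0 x.
  have Ft : `|t - F x| <= e / 2 * `|x|.
    apply/ler_addgt0Pr => d d0; have /cvgr_dist_le /(_ d d0) cx := cu x.
    have [k [/= kn kd]] := filter_ex (filterI (nbhs_infty_ge n0) cx).
    have h1 : `|t - u x k| <= e / 2 * `|x| by rewrite distrC; exact: Ht.
    have h2 : `|u x k - F x| <= d by rewrite distrC; exact: kd.
    by apply: le_trans (ler_distD (u x k) t (F x)) _; rewrite lerD.
  by have := ler_distD t (clin_pow A n x q) (F x); have := Ht n nn q; lra.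
have FE x l : u x @ \oo --> l -> F x = l by move/cvg_lim; apply.
have lF : linear (F : CQ -> R^o).
  move=> a x y; apply: FE.
  have -> : u (a *: x + y) = (fun n => a * u x n + u y n).
    by apply/funext => n; rewrite /u linearP.
  by apply: cvgD; [apply: cvgM; [exact: cvg_cst|exact: cu]|exact: cu].
have F1 x : `|F x| <= `|x|.
  apply/ler_addgt0Pr => d d0; have /cvgr_dist_le /(_ d d0) cx := cu x.
  have [k kd] := filter_ex cx.
  have := markov_norm_le x (markov_pow k mA).
  have := cfun_le_norm (clin_pow A k x) q0; rewrite -/(u x k).
  have h2 : `|F x - u x k| <= d by exact: kd.
  by have := ler_distD (u x k) (F x) 0; rewrite !subr0; lra.
have FP : F \in clin_pred CQ R^o by exact: contractive_clin_pred.
exists (CLin FP).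
  split=> [x x0|] /=.
    apply: limr_ge (cu x) _; apply: nearW => n.
    exact: (markov_pow n mA).1.
  by apply: FE; rewrite /u; under eq_fun do rewrite (markov_pow _ mA).2; exact: cvg_cst.
move=> e /est[n0 Hn0]; exists n0 => n nn x.
apply: norm_cfun_le => [|q].
  by rewrite (le_trans (normr_ge0 _) (Hn0 n nn x q0)).
by rewrite cfunBE cfunZE mulr1; exact: Hn0.
Qed.

Section Consequences.
Variables (A : clin CQ CQ) (f0 : dual CQ).
Hypothesis mA : markov_operator A.
Hypothesis pf0 : probability_functional f0.
Hypothesis lim0 : forall e : R, 0 < e -> exists n0, forall n, (n0 <= n)%N ->
      forall x, `|clin_pow A n x - f0 x *: one| <= e * `|x|.

Lemma limit_cvg : clin_pow A n @[n --> \oo] --> rank_one f0 one.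
Proof.
apply/cvgrPdist_le => e e0; have [n0 Hn0] := lim0 e0; exists n0 => // n /= nn.
by rewrite distrC; apply: opnorm_le; [exact: ltW|exact: Hn0].
Qed.

Lemma limit_adjoint_dist (f : dual CQ) (e : R) n x :
  `|clin_pow A n x - f0 x *: one| <= e * `|x| ->
  `|clin_pow (adjoint A) n f x - f (f0 x *: one)| <= `|f| * (e * `|x|).
Proof.
move=> H; rewrite clin_pow_adjoint -clinB.
by apply: le_trans (opnorm_ge f _) _; apply: ler_wpM2l H; exact: opnorm_ge0.
Qed.

Lemma limit_adjoint_cvg :
  clin_pow (adjoint A) n @[n --> \oo] --> adjoint (rank_one f0 one).
Proof.
apply/cvgrPdist_le => e e0; have [n0 Hn0] := lim0 e0; exists n0 => // n /= nn.
rewrite distrC; apply: opnorm_le => [|f]; first exact: ltW.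
apply: opnorm_le => [|x]; first by rewrite mulr_ge0// ltW.
have := limit_adjoint_dist f (Hn0 n nn x).
have -> : `|f| * (e * `|x|) = e * `|f| * `|x| by ring.
by rewrite !clin_subE adjointE.
Qed.

Lemma limit_weak_star (f : dual CQ) :
  (clin_pow (adjoint A) n f : weak_star CQ) @[n --> \oo] -->
    (adjoint (rank_one f0 one) f : weak_star CQ).
Proof.
apply: weak_star_cvg => x; apply/cvgrPdist_le => e e0.
have d0 : 0 < e / (`|f| * `|x| + 1) by rewrite divr_gt0// ltr_wpDl// mulr_ge0.
have [n0 Hn0] := lim0 d0; exists n0 => // n /= nn.
rewrite distrC; apply: le_trans (limit_adjoint_dist f (Hn0 n nn x)) _.
rewrite mulrCA mulrAC ler_pdivrMr ?ltr_wpDl ?mulr_ge0//.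
by rewrite ler_pM2l// lerDl.
Qed.

Lemma limit_fixed x : (forall n, clin_pow A n x = x) -> x = f0 x *: one.
Proof.
move=> Hx; apply/eqP; rewrite -subr_eq0 -normr_le0; apply/ler_addgt0Pr => d d0.
have d1 : 0 < d / (`|x| + 1) by rewrite divr_gt0// ltr_wpDl.
have [n0 /(_ _ (leqnn _) x)] := lim0 d1; rewrite Hx add0r => /le_trans; apply.
by rewrite mulrAC ler_pdivrMr ?ltr_wpDl// ler_pM2l// lerDl.
Qed.

(** A^n (A y) is near f0 (A y), and A^(n + 1) y, the same function, is near f0 y. *)
Lemma limit_invariant n x : f0 (clin_pow A n x) = f0 x.
Proof.
have [q0 _] := Q0.
suff H (y : CQ) : f0 (A y) = f0 y by elim: n => //= n IH; rewrite H.
apply/eqP; rewrite -subr_eq0 -normr_le0; apply/ler_addgt0Pr => d d0; rewrite add0r.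
have d1 : 0 < d / (`|y| + 1) / 2 by rewrite !divr_gt0// ltr_wpDl.
have [n0 Hn0] := lim0 d1.
have dy : d / (`|y| + 1) / 2 * `|y| <= d / 2.
  by rewrite mulrAC ler_pM2r// mulrAC ler_pdivrMr ?ltr_wpDl// ler_pM2l// lerDl.
have near_y : `|clin_pow A n0.+1 y q0 - f0 y| <= d / 2.
  apply: le_trans dy; apply: le_trans (Hn0 _ (leqnSn _) y).
  by apply: le_trans (cfun_le_norm _ q0); rewrite cfunBE cfunZE mulr1.
have near_Ay : `|clin_pow A n0.+1 y q0 - f0 (A y)| <= d / 2.
  apply: le_trans dy; apply: le_trans (ler_wpM2l (ltW d1) (markov_norm_le y mA)).
  apply: le_trans (Hn0 _ (leqnn _) (A y)).
  apply: le_trans (cfun_le_norm _ q0); rewrite cfunBE cfunZE mulr1.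
  by rewrite -[A y in leRHS]/(clin_pow A 1 y) -clin_powD addn1.
apply: le_trans (ler_distD (clin_pow A n0.+1 y q0) _ _) _.
by rewrite [d]splitr; apply: lerD; rewrite // distrC.
Qed.

Lemma limit_strictly_positive m :
  (forall x, nonneg_cone x -> x != 0 -> forall q, 0 < clin_pow A m x q) ->
  forall x, nonneg_cone x -> x != 0 -> 0 < f0 x.
Proof.
move=> rA x x0 xn0; rewrite -(limit_invariant m).
have [d d0 Hd] := strictly_positive_lower_bound Q0 (rA x x0 xn0).
apply: lt_le_trans d0 _; rewrite -[leLHS](probability_cst d pf0).
by apply: positive_mono => //; case: pf0.
Qed.

Lemma cst_neq0 : one != 0.
Proof.
have [q0 _] := Q0; apply/eqP => /(congr1 (fun x : CQ => x q0)) /= /eqP.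
by rewrite [X in _ == X]/(0 : R) oner_eq0.
Qed.

Lemma limit_adjoint_invariant : adjoint A f0 = f0.
Proof. by apply: clinP => x; exact: (limit_invariant 1 x). Qed.

(** A fixed vector x is fixed by all A^n, hence is the constant f0 x. *)
Lemma limit_simple : simple_eigenvalue A 1.
Proof.
exists one; first exact: cst_neq0.
apply/seteqP; split=> [x /= Ax|_ [c _ <-]] /=.
  exists (f0 x) => //; apply/esym/limit_fixed => n.
  by elim: n => // n IH; rewrite clin_powSE IH Ax scale1r.
by rewrite /eigenspace_of /= scale1r; apply: etrans (clinZ A c one) _; rewrite mA.2.
Qed.

(** A fixed functional f satisfies f x = f (A^n x), which tends to f0 x f(1). *)
Lemma limit_adjoint_simple : simple_eigenvalue (adjoint A) 1.
Proof.
exists f0.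
  apply/eqP => f00; have := pf0.2; rewrite f00 => /eqP.
  by rewrite [X in X == _]/(0 : R) eq_sym oner_eq0.
apply/seteqP; split=> [f /= Af|_ [c _ <-]]; last first.
  rewrite /eigenspace_of /= scale1r; apply: etrans (clinZ (adjoint A) c f0) _.
  by rewrite limit_adjoint_invariant.
exists (f one) => //; apply: clinP => x.
have fA n : clin_pow (adjoint A) n f = f.
  by elim: n => // n IH; rewrite clin_powSE IH Af scale1r.
have <- : f (f0 x *: one) = (f one *: f0) x by rewrite clinZ; exact: mulrC.
apply/eqP; rewrite -subr_eq0 -normr_le0; apply/ler_addgt0Pr => d d0; rewrite add0r.
have d1 : 0 < d / (`|f| * `|x| + 1) by rewrite divr_gt0// ltr_wpDl// mulr_ge0.
have [n0 /(_ _ (leqnn _) x) Hn0] := lim0 d1.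
have := limit_adjoint_dist f Hn0; rewrite fA distrC => /le_trans; apply.
rewrite mulrCA mulrAC ler_pdivrMr ?ltr_wpDl ?mulr_ge0//.
by rewrite ler_pM2l// lerDl.
Qed.

(** As mu (1) = 1, the difference is the value of mu at A^n x - f0 x 1, so the
    bound is independent of mu. *)
Lemma limit_probability (e : R) : 0 < e -> exists n0, forall n, (n0 <= n)%N ->
  forall mu : dual CQ, probability_functional mu ->
    `|clin_pow (adjoint A) n mu - f0| <= e.
Proof.
move=> e0; have [n0 Hn0] := lim0 e0; exists n0 => n nn mu pmu.
apply: opnorm_le => [|x]; first exact: ltW.
have -> : (clin_pow (adjoint A) n mu - f0) x = mu (clin_pow A n x - f0 x *: one).
  rewrite clinB clinZ pmu.2 [f0 x *: 1]mulr1 -clin_pow_adjoint //.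
exact: le_trans (probability_norm _ pmu) (Hn0 n nn x).
Qed.

Lemma limit_probability_cvg (mu : dual CQ) : probability_functional mu ->
  clin_pow (adjoint A) n mu @[n --> \oo] --> f0.
Proof.
move=> pmu; apply/cvgrPdist_le => e /limit_probability[n0 Hn0].
by exists n0 => // n /= nn; rewrite distrC; exact: Hn0.
Qed.

Lemma limit_probability_sup :
  ereal_sup [set (`|clin_pow (adjoint A) n mu - f0|)%:E
    | mu in @probability_functional R Q cQ] @[n --> \oo] --> 0%E.
Proof.
set s := fun n => ereal_sup _.
have s0 n : (0 <= s n)%E.
  apply: (@le_trans _ _ (`|clin_pow (adjoint A) n f0 - f0|)%:E).
    by rewrite lee_fin.
  by apply: ereal_sup_ubound; exists f0.
have se (e : R) : 0 < e -> \forall n \near \oo, (s n <= e%:E)%E.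
  move=> /limit_probability[n0 Hn0]; exists n0 => // n /= nn.
  by apply: ge_ereal_sup => _ [mu pmu <-]; rewrite lee_fin; exact: Hn0.
apply/fine_cvgP; split.
  apply: filterS (se 1 ltr01) => n sn; rewrite ge0_fin_numE//.
  exact: le_lt_trans sn (ltry _).
apply/cvgrPdist_le => e e0; apply: filterS (se e e0) => n sn /=.
rewrite sub0r normrN ger0_norm ?fine_ge0//.
rewrite -lee_fin fineK// ge0_fin_numE//; exact: le_lt_trans sn (ltry _).
Qed.

End Consequences.
End Limit.

Unset Implicit Arguments.
Set Strict Implicit.

Theorem mainTheorem6 (R : realType) (Q : topologicalType)
    (cQ : compact [set: Q]) (Q0 : [set: Q] !=set0)
    (A : clin (cfun (R := R) cQ) (cfun (R := R) cQ)) :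
  markov_operator A ->
  (weakly_compact_operator A ->
    exists2 k : nat, (0 < k)%N & compact_operator (clin_pow A k)) /\
  ((exists2 k : nat, (0 < k)%N & compact_operator (clin_pow A k)) ->
   regularity_condition A ->
   exists A0 : clin (cfun (R := R) cQ) (cfun (R := R) cQ),
     clin_pow A n @[n --> \oo] --> A0 /\
     clin_pow (adjoint A) n @[n --> \oo] --> adjoint A0 /\
     exists (u : cfun (R := R) cQ) (f0 : dual (cfun (R := R) cQ)),
       interior (@nonneg_cone R Q cQ) u /\
       positive_functional f0 /\
       (* (i) *)
       (A u = u /\ adjoint A f0 = f0 /\ f0 u = 1 /\
        (forall x : cfun (R := R) cQ, nonneg_cone x -> x != 0 -> 0 < f0 x)) /\
       (* (ii) *)
       A0 = rank_one f0 u /\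
       (* (iii) *)
       (forall f : dual (cfun (R := R) cQ),
          (clin_pow (adjoint A) n f : weak_star (cfun (R := R) cQ))
            @[n --> \oo] --> (adjoint A0 f : weak_star (cfun (R := R) cQ))) /\
       (* (iv) *)
       (simple_eigenvalue A 1 /\ simple_eigenvalue (adjoint A) 1) /\
       (* (v) *)
       (ereal_sup [set (`|clin_pow (adjoint A) n mu - f0|)%:E
                    | mu in @probability_functional R Q cQ]
          @[n --> \oo] --> 0%E) /\
       (forall mu : dual (cfun (R := R) cQ), probability_functional mu ->
          clin_pow (adjoint A) n mu @[n --> \oo] --> f0)).
Proof.
move=> mA; split=> [wA|[k _ cA] [m _ rA]].
  by exists 2%N => //; exact: weakly_compact_markov_sqr.
have stab := uniform_stabilization Q0 mA cA rA.
have [f0 pf0 lim0] := limit_functional Q0 mA stab.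
exists (rank_one f0 (cfun_cst cQ 1)); split; first exact: limit_cvg.
split; first exact: limit_adjoint_cvg.
exists (cfun_cst cQ 1), f0; split; first exact: cst_interior.
split; first by case: pf0.
split.
  split; first by case: mA.
  split; first exact: limit_adjoint_invariant.
  by split; [case: pf0|exact: limit_strictly_positive rA].
split=> //; split; first exact: limit_weak_star.
split; first by split; [exact: limit_simple mA lim0|exact: limit_adjoint_simple lim0].
by split; [exact: limit_probability_sup|exact: limit_probability_cvg].
Qed.
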